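(* Let $G$ be a nontrivial connected graph, and let $B$ be a block of $G$ such that $\mathrm{srd}(B)$ is maximum among all blocks of $G$. Then $\mathrm{srd}(G)=\mathrm{srd}(B)$.
   Context: All graphs are simple, finite and undirected. A block of a graph is a maximal connected subgraph containing no cut-vertex. An edge-coloring of $G$ is any map $c:E(G)\to[k]$ (adjacent edges may receive the same color). For distinct vertices $u,v$ of a connected graph $G$, a $u$-$v$-edge-cut is a set $F$ of edges such that $u$ and $v$ lie in different components of $G-F$; a minimum $u$-$v$-edge-cut is one of minimum size among these. A set of edges is rainbow if no two of its edges have the same color. An edge-colored connected graph is strong rainbow disconnected if for every two distinct vertices $u,v$ there is a $u$-$v$-edge-cut that is both rainbow and minimum; $\mathrm{srd}(G)$ is the smallest number of colors of an edge-coloring making $G$ strong rainbow disconnected. *)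

(* Defs.v *)
From mathcomp Require Import all_boot.

Set Implicit Arguments.
Unset Strict Implicit.
Unset Printing Implicit Defensive.

(* Finite simple graphs whose vertices are taken in an ambient finite type T.
   An edge is the two-element set of its ends, so a graph and its subgraphs
   all have the same type [graph T]. *)
Definition graph_wf (T : finType) (V : {set T}) (E : {set {set T}}) : bool :=
  [forall e in E, (#|e| == 2) && (e \subset V)].

Record graph (T : finType) := Graph {
  verts : {set T};
  edges : {set {set T}};
  _ : graph_wf verts edges
}.

Section Graphs.
Variable T : finType.
Implicit Types (G H B : graph T) (F : {set {set T}}) (u v x : T).

Definition adj G : rel T := fun u v => [set u; v] \in edges G.

Definition subgraph H G : bool :=
  (verts H \subset verts G) && (edges H \subset edges G).

Definition graph_connected G : bool :=
  (verts G != set0) &&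
  [forall u in verts G, forall v in verts G, connect (adj G) u v].

Fact del_edges_wf G F : graph_wf (verts G) (edges G :\: F).
Proof.
case: G => V E /= /forall_inP wf; apply/forall_inP => e.
by rewrite inE => /andP[_ /wf].
Qed.

Definition del_edges G F : graph T := Graph (del_edges_wf G F).

Fact del_vertex_wf G x :
  graph_wf (verts G :\ x) [set e in edges G | x \notin e].
Proof.
case: G => V E /= /forall_inP wf; apply/forall_inP => e.
rewrite inE => /andP[/wf /andP[-> sub] xe] /=.
by rewrite subsetD1 sub xe.
Qed.

Definition del_vertex G x : graph T := Graph (del_vertex_wf G x).

Definition num_components G : nat := n_comp (adj G) (verts G).

Definition cut_vertex G x : bool :=
  (x \in verts G) && (num_components G < num_components (del_vertex G x)).

Definition connected_no_cut_vertex H : bool :=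
  graph_connected H && [forall x, ~~ cut_vertex H x].

Definition is_block G B : Prop :=
  [/\ subgraph B G, connected_no_cut_vertex B &
      forall H, subgraph H G -> connected_no_cut_vertex H ->
        subgraph B H -> H = B].

Definition edge_cut G u v F : bool :=
  (F \subset edges G) && ~~ connect (adj (del_edges G F)) u v.

Definition min_edge_cut G u v F : bool :=
  edge_cut G u v F && [forall F', edge_cut G u v F' ==> (#|F| <= #|F'|)].

Definition edge G := {e : {set T} | e \in edges G}.

(* Colors are assigned to the edges of G only: a graph without edges has a
   coloring with 0 colors. *)
Definition coloring G (k : nat) := {ffun edge G -> 'I_k}.

Definition rainbow G k (c : coloring G k) F : bool :=
  dinjectiveb c [pred e | val e \in F].

Definition strong_rainbow_disconnected G k (c : coloring G k) : bool :=
  [forall u in verts G, forall v in verts G, (u != v) ==>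
    [exists F : {set {set T}}, rainbow c F && min_edge_cut G u v F]].

Definition srd_colorable G (k : nat) : bool :=
  [exists c : coloring G k, strong_rainbow_disconnected c].

Fact edge_cut_all G u v : u != v -> edge_cut G u v (edges G).
Proof.
move=> uv; rewrite /edge_cut subxx /=; apply/negP => /connectP[[|w p] /=].
  by move=> _ E; rewrite E eqxx in uv.
by rewrite /adj /= setDv inE.
Qed.

Fact ex_min_edge_cut G u v : u != v -> exists F, min_edge_cut G u v F.
Proof.
move=> /(edge_cut_all G) cutE.
case: (arg_minnP (fun F => #|F|) cutE) => F cutF minF.
by exists F; rewrite /min_edge_cut cutF; apply/forall_inP.
Qed.

Fact ex_srd_colorable G : exists k, srd_colorable G k.
Proof.
exists #|{: edge G}|; apply/existsP.
exists [ffun e => enum_rank e].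
apply/forall_inP => u _; apply/forall_inP => v _; apply/implyP => uv.
have [F minF] := ex_min_edge_cut G uv.
apply/existsP; exists F; rewrite minF andbT.
by apply/dinjectiveP => e e' _ _; rewrite !ffunE; apply: enum_rank_inj.
Qed.

Definition srd G : nat := ex_minn (ex_srd_colorable G).

End Graphs.

(* Main.v *)
(* Minimum cuts are local to blocks.  A path of G joining two vertices of a
   block B stays inside B, since B together with such a path still has no
   cut-vertex; hence the minimum cuts of B separating two of its vertices are
   minimum cuts of G, and colorings of G restrict to B.  Conversely, color every
   block optimally.  If v lies outside the block B of the first edge of a path
   from u to v, every such path passes through the attachment vertex w of v on B,
   so that a set of edges separates u and v exactly when it separates u and w or
   w and v; the smaller of two rainbow minimum cuts, one for each of these
   pairs, then serves u and v, by induction on the length of the path. *)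
Require Import Defs.
From mathcomp Require Import all_boot.

Section BlockColorings.
Set Implicit Arguments.
Unset Strict Implicit.
Variable T : finType.
Implicit Types (G H K B : graph T) (F : {set {set T}}) (e : {set T}) (u v w x y z : T).

(** * Adjacency, connectivity and components *)

Lemma graph_ext {G H} : verts G = verts H -> edges G = edges H -> G = H.
Proof.
case: G => V E wf; case: H => V' E' wf' /= eV eE; subst V' E'.
by rewrite (eq_irrelevance wf wf').
Qed.

Lemma edge_wf {G} {e : {set T}} : e \in edges G -> (#|e| == 2) && (e \subset verts G).
Proof. by case: G => V E /= /forall_inP wf /wf. Qed.

Lemma adj_sym G : symmetric (adj G).
Proof. by move=> u v; rewrite /adj setUC. Qed.

Lemma connect_adjC G : connect_sym (adj G).
Proof. exact: sym_connect_sym (adj_sym G). Qed.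

Lemma adj_verts {G u v} : adj G u v -> (u \in verts G) && (v \in verts G).
Proof. by move=> /edge_wf /andP[_]; rewrite subUset !sub1set. Qed.

Lemma connect_verts {G u v} : connect (adj G) u v -> u \in verts G -> v \in verts G.
Proof.
move=> uv; have cl : closed (adj G) (verts G).
  by move=> x y /adj_verts /andP[-> ->].
by rewrite (closed_connect cl uv).
Qed.

Lemma adj_del_vertex G z u v :
  adj (del_vertex G z) u v = [&& adj G u v, z != u & z != v].
Proof. by rewrite /adj inE !inE negb_or. Qed.

Lemma verts_del_vertex G z u :
  (u \in verts (del_vertex G z)) = (u != z) && (u \in verts G).
Proof. by rewrite !inE. Qed.

Lemma adj_del_edges G F u v :
  adj (del_edges G F) u v = ([set u; v] \notin F) && adj G u v.
Proof. by rewrite /adj !inE. Qed.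

Lemma num_components_le1 G :
  num_components G <= 1 <->
  {in verts G &, forall u v, connect (adj G) u v}.
Proof.
split=> [/card_le1_eqP le1 u v uV vV | conn].
  have rV w : w \in verts G -> fingraph.root (adj G) w \in [predI roots (adj G) & verts G].
    move=> wV; rewrite !inE roots_root //=; last exact: connect_adjC.
    exact: connect_verts (connect_root _ _) wV.
  rewrite -(root_connect (connect_adjC G)); apply/eqP.
  by apply: le1; apply: rV.
apply/card_le1_eqP => u v; rewrite !inE => /andP[/eqP ru uV] /andP[/eqP rv vV].
rewrite -ru -rv; apply/eqP; rewrite (root_connect (connect_adjC G)).
exact: conn.
Qed.

Lemma num_components_gt0 G u : u \in verts G -> 0 < num_components G.
Proof.
move=> uV; apply/card_gt0P; exists (fingraph.root (adj G) u).
rewrite !inE roots_root //=; last exact: connect_adjC.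
exact: connect_verts (connect_root _ _) uV.
Qed.

Lemma del_vertex_notin G z : z \notin verts G -> del_vertex G z = G.
Proof.
move=> zV; apply: graph_ext.
  by apply/setP => x; rewrite !inE; case: eqP zV => // -> /negPf.
apply/setP => e; rewrite inE; case eE: (e \in edges G) => //=; apply: contra zV.
by have /andP[_ /subsetP sub] := edge_wf eE; apply: sub.
Qed.

(** * Graphs without cut-vertex and their unions *)

(** A connected graph has exactly one component, so a cut-vertex is one whose deletion leaves at
    least two. A one-vertex graph is left with none, and a [z] outside [H] deletes nothing. *)
Lemma connected_no_cut_vertexP H :
  connected_no_cut_vertex H <->
  graph_connected H /\
  forall z, {in verts (del_vertex H z) &,
               forall u v, connect (adj (del_vertex H z)) u v}.
Proof.
split=> [/andP[cH /forallP ncut] | [cH conn]].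
  have /andP[_ /forall_inP cHP] := cH.
  have cHV : {in verts H &, forall u v, connect (adj H) u v}.
    by move=> u v uV vV; apply: (forall_inP (cHP u uV)).
  split=> // z; have [zV | zV] := boolP (z \in verts H); last first.
    by rewrite del_vertex_notin.
  apply/num_components_le1; move: (ncut z).
  rewrite /cut_vertex zV /= -leqNgt => le1; apply: leq_trans le1 _.
  exact/num_components_le1.
rewrite /connected_no_cut_vertex cH; apply/forallP => z.
rewrite /cut_vertex; case zV: (z \in verts H) => //=.
rewrite -leqNgt; apply: leq_trans (num_components_gt0 zV).
exact/num_components_le1.
Qed.

Lemma edges_connect {H K} : edges H \subset edges K ->
  subrel (connect (adj H)) (connect (adj K)).
Proof.
move=> /subsetP sub; apply: connect_sub => x y xy.
exact/connect1/sub.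
Qed.

Lemma graph_join_wf H K :
  graph_wf (verts H :|: verts K) (edges H :|: edges K).
Proof.
apply/forall_inP => e; rewrite inE => /orP[] /edge_wf /andP[-> sub] /=;
  apply: subset_trans sub _; [exact: subsetUl | exact: subsetUr].
Qed.

(** The plain union: no edges are added between [H] and [K], unlike in the graph-theoretic join. *)
Definition graph_join H K : graph T := Graph (graph_join_wf H K).

Lemma subgraph_joinl H K : subgraph H (graph_join H K).
Proof. by rewrite /subgraph !subsetUl. Qed.

Lemma subgraph_joinr H K : subgraph K (graph_join H K).
Proof. by rewrite /subgraph !subsetUr. Qed.

Lemma subgraph_join G H K :
  subgraph H G -> subgraph K G -> subgraph (graph_join H K) G.
Proof. by move=> /andP[vH eH] /andP[vK eK]; rewrite /subgraph !subUset vH vK eH. Qed.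

Lemma edges_del_vertexS H K z : subgraph H K ->
  edges (del_vertex H z) \subset edges (del_vertex K z).
Proof.
move=> /andP[_ /subsetP sub]; apply/subsetP => e.
by rewrite !inE => /andP[/sub -> ->].
Qed.

Lemma edges_del_vertex H z : edges (del_vertex H z) \subset edges H.
Proof. by apply/subsetP => e; rewrite inE => /andP[]. Qed.

(** Since [H] minus [z] stays connected, it is enough that each vertex of [K] surviving the deletion
    still reaches a survivor of [H]. This form serves both overlapping blocks and paths attached to
    a block. *)
Lemma join_no_cut_vertex H K : connected_no_cut_vertex H ->
  (forall z u, u \in verts K -> u != z ->
     exists v, [/\ v \in verts H, v != z & connect (adj (del_vertex K z)) u v]) ->
  connected_no_cut_vertex (graph_join H K).
Proof.
move=> /connected_no_cut_vertexP[/andP[/set0Pn[x xH] /forall_inP cH] nH] att.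
apply/connected_no_cut_vertexP; split.
  have toX u : u \in verts (graph_join H K) -> connect (adj (graph_join H K)) u x.
    have cJ v : v \in verts H -> connect (adj (graph_join H K)) v x.
      move=> vH; apply: (edges_connect (H := H)); first exact: subsetUl.
      exact: (forall_inP (cH v vH)).
    rewrite inE => /orP[/cJ // | uK].
    have [-> // | ux] := eqVneq u x.
    (* Taking the base vertex [x] as the deleted one loses nothing: whichever vertex of [H] is
       reached leads on to [x]. *)
    have [v [vH _ uv]] := att x u uK ux.
    apply: connect_trans (cJ v vH); apply: edges_connect uv.
    exact: subset_trans (edges_del_vertex _ _) (subsetUr _ _).
  apply/andP; split; first by apply/set0Pn; exists x; rewrite inE xH.
  apply/forall_inP => u /toX ux; apply/forall_inP => v /toX.
  by rewrite connect_adjC; apply: connect_trans.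
move=> z.
have toH u : u \in verts (del_vertex (graph_join H K) z) ->
    exists2 v, v \in verts (del_vertex H z) &
      connect (adj (del_vertex (graph_join H K) z)) u v.
  rewrite verts_del_vertex inE => /andP[uz /orP[uH | uK]].
    by exists u => //; rewrite verts_del_vertex uz.
  have [v [vH vz uv]] := att z u uK uz.
  exists v; first by rewrite verts_del_vertex vz.
  exact: edges_connect (edges_del_vertexS z (subgraph_joinr H K)) _ _ uv.
move=> u v /toH[u' u'H uu'] /toH[v' v'H]; rewrite connect_adjC => v'v.
apply: connect_trans uu' (connect_trans _ v'v).
exact: edges_connect (edges_del_vertexS z (subgraph_joinl H K)) _ _ (nH z _ _ u'H v'H).
Qed.

(** * Existence and uniqueness of blocks *)

Lemma subgraph_refl H : subgraph H H.
Proof. by rewrite /subgraph !subxx. Qed.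

Lemma subgraph_trans {H K G} : subgraph H K -> subgraph K G -> subgraph H G.
Proof.
by move=> /andP[vH eH] /andP[vK eK]; rewrite /subgraph (subset_trans vH) ?(subset_trans eH).
Qed.

(* Codes graphs by a finite type, so that maximal ones and choices among them
   exist without choice axioms; sets that cannot be edges are discarded. *)
Lemma graph_of_wf (V : {set T}) (E : {set {set T}}) :
  graph_wf V [set e in E | (#|e| == 2) && (e \subset V)].
Proof. by apply/forall_inP => e; rewrite inE => /andP[]. Qed.

Definition graph_of (VE : {set T} * {set {set T}}) : graph T :=
  Graph (graph_of_wf VE.1 VE.2).

Lemma graph_ofK H : graph_of (verts H, edges H) = H.
Proof.
apply: graph_ext => //; apply/setP => e; rewrite inE /=.
by case eE: (e \in edges H) => //=; exact: edge_wf eE.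
Qed.

(** Take an extension without cut-vertex that maximizes the number of vertices plus edges: any such
    graph above it has the same counts and so coincides with it. *)
Lemma block_exists {G H} : subgraph H G -> connected_no_cut_vertex H ->
  exists2 B, is_block G B & subgraph H B.
Proof.
move=> HG nH.
pose Q K := [&& subgraph K G, connected_no_cut_vertex K & subgraph H K].
pose size_of K := #|verts K| + #|edges K|.
have QH : Q (graph_of (verts H, edges H)).
  by rewrite graph_ofK /Q HG nH subgraph_refl.
case: (arg_maxnP (P := fun VE => Q (graph_of VE)) (fun VE => size_of (graph_of VE)) QH).
move=> VE; move: (graph_of VE) => B /and3P[BG nB HB] maxB.
exists B => //; split=> // K KG nK BK.
have := maxB (verts K, edges K); rewrite graph_ofK /Q KG nK (subgraph_trans HB) //.
case/andP: BK => vBK eBK /(_ isT) le_size.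
apply/esym/graph_ext; apply/eqP; rewrite eqEcard ?vBK ?eBK /=.
  by rewrite -(leq_add2r #|edges B|); apply: leq_trans le_size; rewrite leq_add2l subset_leq_card.
rewrite -(leq_add2l #|verts B|); apply: leq_trans le_size.
by rewrite leq_add2r subset_leq_card.
Qed.

Lemma induced_wf G (S : {set T}) : graph_wf S [set e in edges G | e \subset S].
Proof.
apply/forall_inP => e; rewrite inE => /andP[/edge_wf /andP[-> _] ->].
by [].
Qed.

Definition induced G (S : {set T}) : graph T := Graph (induced_wf G S).

Lemma subgraph_induced G (S : {set T}) : S \subset verts G -> subgraph (induced G S) G.
Proof.
move=> sub; rewrite /subgraph sub; apply/subsetP => e.
by rewrite inE => /andP[].
Qed.

Lemma adj_induced G (S : {set T}) u v :
  adj (induced G S) u v = [&& adj G u v, u \in S & v \in S].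
Proof. by rewrite /adj inE subUset !sub1set. Qed.

(** One edge with its two ends has no cut-vertex, and so extends to a block. *)
Lemma block_of_edge G (e : {set T}) : e \in edges G ->
  exists2 B, is_block G B & e \in edges B.
Proof.
move=> eG; have /andP[e2 sub] := edge_wf eG.
have pairE x y : x \in e -> y \in e -> x != y -> [set x; y] = e.
  move=> xe ye xy; apply/eqP.
  by rewrite eqEcard subUset !sub1set xe ye cards2 xy (eqP e2).
have nK : connected_no_cut_vertex (induced G e).
  apply/connected_no_cut_vertexP; split.
    apply/andP; split; first by rewrite /= -card_gt0 (eqP e2).
    apply/forall_inP => x /= xe; apply/forall_inP => y /= ye.
    have [-> // | xy] := eqVneq x y.
    by apply: connect1; rewrite adj_induced xe ye /adj (pairE x y) ?eG.
  move=> z x y; rewrite !verts_del_vertex /= => /andP[xz xe] /andP[yz ye].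
  have [-> // | xy] := eqVneq x y.
  apply: connect1; rewrite adj_del_vertex adj_induced xe ye /adj (pairE x y) //.
  by rewrite eG ![z == _]eq_sym xz yz.
have [B bB /andP[_ /subsetP KB]] := block_exists (subgraph_induced sub) nK.
by exists B => //; apply: KB; rewrite inE eG subxx.
Qed.

Lemma block_join G B K : is_block G B -> subgraph K G ->
  connected_no_cut_vertex (graph_join B K) -> subgraph K B.
Proof.
move=> [BG _ maxB] KG nJ.
by rewrite -(maxB _ (subgraph_join BG KG) nJ (subgraph_joinl B K)) subgraph_joinr.
Qed.

(** Blocks sharing an edge share both its ends. Whichever vertex is deleted, one end survives and
    links the two remainders, so the union has no cut-vertex and maximality applies. *)
Lemma block_unique G B B' (e : {set T}) : is_block G B -> is_block G B' ->
  e \in edges B -> e \in edges B' -> B = B'.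
Proof.
move=> bB bB' eB eB'; have [BG nB _] := bB; have [B'G nB' maxB'] := bB'.
have /andP[/cards2P[x [y [xy eE]]] sB] := edge_wf eB.
have /andP[_ sB'] := edge_wf eB'.
have xyB w : w \in [set x; y] -> (w \in verts B) && (w \in verts B').
  by rewrite -eE => we; rewrite (subsetP sB) ?(subsetP sB').
have B'B : subgraph B' B.
  apply: block_join bB B'G (join_no_cut_vertex nB _) => z u uB' uz.
  have [w wxy wz] : exists2 w, w \in [set x; y] & w != z.
    have [xz | xz] := eqVneq x z; last by exists x; rewrite ?inE ?eqxx.
    by exists y; rewrite ?inE ?eqxx ?orbT // -xz eq_sym.
  have /andP[wB wB'] := xyB w wxy.
  exists w; split=> //; move/connected_no_cut_vertexP: nB' => [_]; apply.
    by rewrite verts_del_vertex uz.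
  by rewrite verts_del_vertex wz.
exact: maxB'.
Qed.

(** * Paths between vertices of a block *)

(** Deleting [z] cuts the path into at most two segments, each holding an end of the path; chords of
    the induced graph do no harm. *)
Lemma connect_del_path G x p z u : path (adj G) x p -> uniq (x :: p) ->
  u \in x :: p -> u != z ->
  (x != z) && connect (adj (del_vertex (induced G [set w in x :: p]) z)) u x ||
  (last x p != z) && connect (adj (del_vertex (induced G [set w in x :: p]) z)) u (last x p).
Proof.
set K := induced G _ => xp Up up uz.
have sub_path a q : {subset a :: q <= x :: p} -> path (adj G) a q -> z \notin a :: q ->
    connect (adj (del_vertex K z)) a (last a q).
  move=> sub aq zq; apply/connectP; exists q => //.
  elim: q a sub aq zq => //= b q IH a sub /andP[ab bq].
  rewrite !inE !negb_or => /and3P[za zb zq].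
  have aS : a \in x :: p by apply: sub; rewrite mem_head.
  have bS : b \in x :: p by apply: sub; rewrite !inE eqxx orbT.
  rewrite adj_del_vertex adj_induced ab za zb !in_set aS bS /=.
  by apply: IH; rewrite ?inE ?negb_or ?zb // => c cq; apply: sub; rewrite inE cq orbT.
have [xE | [p1 [p2 [pE lE]]]] : (u = x) \/ exists p1 p2, p = p1 ++ p2 /\ last x p1 = u.
- move: up; rewrite inE => /predU1P[-> | /splitPr[p1 p2]]; first by left.
  by right; exists (rcons p1 u), p2; rewrite cat_rcons last_rcons.
- by rewrite -xE uz connect0.
move: xp Up sub_path; rewrite pE cat_path lE => /andP[xp1 up2] Up sub_path.
(* If [z] comes after [u], walk back to [x]; otherwise walk forward along [p2] to the last
   vertex. *)
have [zp2 | zp2] := boolP (z \in p2); last first.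
  apply/orP; right; rewrite last_cat lE.
  have zu : z \notin u :: p2 by rewrite inE negb_or eq_sym uz.
  rewrite sub_path ?andbT //.
    by apply: contraNneq zu => <-; apply: mem_last.
  move=> c; rewrite !inE mem_cat => /predU1P[-> | ->]; rewrite ?orbT //.
  by have := mem_last x p1; rewrite lE inE => /orP[-> | ->]; rewrite ?orbT.
have zp1 : z \notin x :: p1.
  by move: Up; rewrite -cat_cons cat_uniq => /and3P[_ /hasPn/(_ z zp2)].
apply/orP; left; rewrite connect_adjC -lE sub_path ?andbT //.
  by move: zp1; rewrite inE negb_or eq_sym => /andP[->].
by move=> c; rewrite -cat_cons mem_cat => ->.
Qed.

(** After any deletion each surviving vertex of the path still reaches an end of it, which lies in
    [B]. Adding the path thus creates no cut-vertex, and maximality puts it inside [B]. *)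
Lemma block_path_edges G B x p : is_block G B -> path (adj G) x p ->
  uniq (x :: p) -> x \in verts B -> last x p \in verts B ->
  subgraph (induced G [set w in x :: p]) B.
Proof.
move=> bB xp Up xB yB; have [BG nB _] := bB.
apply: (block_join bB) => //.
  apply: subgraph_induced; apply/subsetP => w; rewrite inE.
  have /andP[/subsetP/(_ x xB) xG _] := BG.
  elim: p x xp xG {Up xB yB} => [|a p IH] x /=; first by rewrite !inE => _ ? /eqP->.
  move=> /andP[/adj_verts /andP[xG aG] ap] _; rewrite inE => /predU1P[-> // |].
  exact: IH.
apply: join_no_cut_vertex nB _ => z u; rewrite inE => up uz.
by have /orP[] := connect_del_path xp Up up uz => /andP[hz cz]; [exists x | exists (last x p)].
Qed.

Lemma block_connect G B F x y : is_block G B -> x \in verts B -> y \in verts B ->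
  connect (adj (del_edges G F)) x y -> connect (adj (del_edges B F)) x y.
Proof.
move=> bB xB + /connectP[p0 xp0 yE]; rewrite {y}yE.
(* Only a path without repeated vertices is known to stay in [B]. *)
case: (shortenP xp0) => p xp Up _ yB {p0 xp0}.
have xpG : path (adj G) x p.
  by apply: sub_path xp => a b; rewrite adj_del_edges => /andP[].
have /andP[_ /subsetP sub] := block_path_edges bB xpG Up xB yB.
apply/connectP; exists p => //.
apply: sub_in_path (allss (x :: p)) xp => a b ap bp.
rewrite !adj_del_edges => /andP[-> ab] /=; apply: sub.
by rewrite -/(adj _ a b) adj_induced ab !in_set ap bp.
Qed.

(** * Edge cuts in a block and across attachment vertices *)

Lemma edge_cut_block G B u v F : is_block G B -> u \in verts B -> v \in verts B ->
  edge_cut B u v F -> edge_cut G u v F.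
Proof.
move=> bB uB vB /andP[FB nuv]; have [/andP[_ BG] _ _] := bB.
rewrite /edge_cut (subset_trans FB BG); apply: contra nuv.
exact: block_connect bB uB vB.
Qed.

Lemma edge_cut_subgraph G H u v F : subgraph H G ->
  edge_cut G u v F -> edge_cut H u v (F :&: edges H).
Proof.
move=> /andP[_ /subsetP HG] /andP[_ nuv]; rewrite /edge_cut subsetIr.
apply: contra nuv; apply: edges_connect; apply/subsetP => e.
by rewrite !inE => /andP[+ eH]; rewrite eH andbT HG // andbT.
Qed.

Lemma min_edge_cut_block G B u v F : is_block G B -> u \in verts B -> v \in verts B ->
  min_edge_cut B u v F -> min_edge_cut G u v F.
Proof.
move=> bB uB vB /andP[cF /forall_inP minF]; have [BG _ _] := bB.
rewrite /min_edge_cut (edge_cut_block bB) //; apply/forall_inP => F' cF'.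
apply: leq_trans (minF _ (edge_cut_subgraph BG cF')) _.
exact/subset_leq_card/subsetIl.
Qed.

(** Restriction keeps a cut, and every rival in [B] is also a cut of [G], so it already has at least
    [#|F|] edges. *)
Lemma min_edge_cut_restrict G B u v F : is_block G B -> u \in verts B -> v \in verts B ->
  min_edge_cut G u v F -> min_edge_cut B u v (F :&: edges B).
Proof.
move=> bB uB vB /andP[cF /forall_inP minF]; have [BG _ _] := bB.
rewrite /min_edge_cut (edge_cut_subgraph BG) //; apply/forall_inP => F' cF'.
apply: leq_trans (minF _ (edge_cut_block bB uB vB cF')).
exact/subset_leq_card/subsetIl.
Qed.

(* [w] is the attachment vertex of [v] on [B]. *)
Lemma connect_attachment G B F u v w : is_block G B -> u \in verts B -> w \in verts B ->
  connect (adj (del_edges G (edges B))) w v ->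
  connect (adj (del_edges G F)) u v -> connect (adj (del_edges G F)) u w.
Proof.
move=> bB uB wB wv /connectP[p up vE]; rewrite {v}vE in wv.
(* With all edges of [B] removed, [block_connect] yields a path in an edgeless graph, which is
   trivial. *)
have attE x : x \in verts B -> connect (adj (del_edges G (edges B))) w x -> w = x.
  move=> xB /(block_connect bB wB xB) /connectP[[|a q] //=].
  by rewrite adj_del_edges /adj; case: (_ \in _).
(* Peel off the last edge. If it lies in [B], its far end is a vertex of [B] attached at [w], hence
   is [w]; if not, its near end is still attached at [w]. *)
elim/last_ind: p up wv => [|p y IH] /=; first by move=> _ /(attE u uB) ->.
rewrite last_rcons rcons_path => /andP[up py] wy.
have [eB | eB] := boolP ([set last u p; y] \in edges B).
  have /andP[_ yB] := adj_verts eB.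
  rewrite (attE y yB wy); apply: connect_trans (connect1 py).
  by apply/connectP; exists p.
apply: IH => //; apply: connect_trans wy (connect1 _).
rewrite adj_sym adj_del_edges eB.
by move: py; rewrite adj_del_edges => /andP[_ ->].
Qed.

(** Here [w] is the last vertex of [B] on the path and [q] the rest; the bound on the length of [q]
    feeds the later induction over paths. *)
Lemma path_attachment G B u p : is_block G B -> u \in verts B -> path (adj G) u p ->
  exists w q, [/\ w \in verts B, connect (adj (del_edges G (edges B))) w (last u p),
                  path (adj G) w q, last w q = last u p & size q <= size p].
Proof.
move=> bB; have [n] := ubnP (size p); elim: n u p => // n IH u p lt_n uB up.
have [/hasP[x xp xB] | out] := boolP (has [in verts B] p).
  case: (splitPr xp) lt_n up => p1 p2.
  rewrite size_cat cat_path last_cat /= ltnS => lt_n /and3P[_ _ xp2].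
  have [|w [q [wB wv wq qE le_q]]] := IH x p2 _ xB xp2.
    by apply: leq_trans lt_n; apply: leq_addl.
  exists w, q; split=> //; apply: leq_trans le_q _.
  by rewrite -addSnnS leq_addl.
(* No later vertex lies in [B], so no edge of the path belongs to [B]. *)
exists u, p; split=> //; apply/connectP; exists p => //.
elim: p u up out {lt_n uB} => //= a p IHp u /andP[ua ap].
rewrite negb_or => /andP[aB out]; rewrite IHp // adj_del_edges ua !andbT.
by apply: contra aB => /adj_verts /andP[].
Qed.

(** Any cut between [u] and [v] also separates [u] from [w] or [w] from [v], so it is at least as
    large as the smaller of [F1] and [F2]. *)
Lemma min_edge_cut_separator G u v w F1 F2 :
  (forall F, edge_cut G u w F -> edge_cut G u v F) ->
  (forall F, edge_cut G w v F -> edge_cut G u v F) ->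
  min_edge_cut G u w F1 -> min_edge_cut G w v F2 ->
  min_edge_cut G u v F1 || min_edge_cut G u v F2.
Proof.
move=> uw wv /andP[c1 /forall_inP m1] /andP[c2 /forall_inP m2].
rewrite /min_edge_cut uw // wv //=.
have minF F : edge_cut G u v F -> minn #|F1| #|F2| <= #|F|.
  move=> /andP[FG nuv]; rewrite geq_min.
  have [cuw | nuw] := boolP (connect (adj (del_edges G F)) u w); last first.
    by rewrite m1 // /edge_cut FG.
  rewrite m2 ?orbT // /edge_cut FG; apply: contra nuv.
  exact: connect_trans.
by case: (leqP #|F1| #|F2|) minF => _ minF; apply/orP; [left | right];
  apply/forall_inP.
Qed.

(** * Colorings of a graph and of its blocks *)

(** Colors are natural numbers on arbitrary vertex sets, so one function can be read on [G] and on
    each block; the number of colors is bounded separately. *)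
Definition rainbow_cuts G (f : {set T} -> nat) : Prop :=
  {in verts G &, forall u v, u != v ->
     exists2 F : {set {set T}}, {in F &, injective f} & min_edge_cut G u v F}.

Lemma srd_colorableP G k : srd_colorable G k <->
  exists2 f : {set T} -> nat, {in edges G, forall e, f e < k} & rainbow_cuts G f.
Proof.
split=> [/existsP[c /forall_inP srdc] | [f ltf cutf]].
  (* The default 0 off [edges G] is never consulted, as cuts consist of edges. *)
  exists (fun e => if insub e is Some e' then nat_of_ord (c e') else 0).
    by move=> e eG; rewrite insubT /=.
  move=> u v uG vG uv; have /forall_inP/(_ v vG) := srdc u uG.
  rewrite uv => /existsP[F /andP[/dinjectiveP injc minF]]; exists F => // e e' eF e'F.
  have /andP[/andP[/subsetP FG _] _] := minF.
  rewrite !insubT ?FG //= => eG e'G /val_inj /injc.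
  by rewrite !inE /= => /(_ eF e'F) [].
apply/existsP; exists [ffun e : edge G => Ordinal (ltf (val e) (valP e))].
apply/forall_inP => u uG; apply/forall_inP => v vG; apply/implyP => uv.
have [F injf minF] := cutf u v uG vG uv; apply/existsP; exists F; rewrite minF andbT.
apply/dinjectiveP => e e'; rewrite !inE !ffunE => eF e'F /(congr1 val) /= fE.
exact/val_inj/injf.
Qed.

Lemma srd_colorable_srd G : srd_colorable G (srd G).
Proof. by rewrite /srd; case: ex_minnP. Qed.

Lemma srd_min G k : srd_colorable G k -> srd G <= k.
Proof. by rewrite /srd; case: ex_minnP => m _ minm /minm. Qed.

Lemma srd_block_le G B : is_block G B -> srd B <= srd G.
Proof.
move=> bB; have [/andP[/subsetP vBG /subsetP eBG] _ _] := bB.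
have /srd_colorableP[f ltf cutf] := srd_colorable_srd G.
apply/srd_min/srd_colorableP; exists f => [e /eBG /ltf // | u v uB vB uv].
have [F injf minF] := cutf u v (vBG u uB) (vBG v vB) uv.
exists (F :&: edges B); last exact: min_edge_cut_restrict bB uB vB minF.
by move=> e e'; rewrite !inE => /andP[eF _] /andP[e'F _]; apply: injf.
Qed.

Lemma rainbow_cuts_blocks G f : graph_connected G ->
  (forall B, is_block G B -> rainbow_cuts B f) -> rainbow_cuts G f.
Proof.
move=> /andP[_ /forall_inP cG] cutB u v uG vG.
have /connectP[p up ->] := forall_inP (cG u uG) v vG.
have [n] := ubnP (size p); elim: n u p up {uG v vG} => // n IH u [|x p] /=.
  by rewrite eqxx.
move=> /andP[ux xp]; rewrite ltnS => le_n; set v := last x p => uv.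
have [B bB eB] := block_of_edge ux.
have /andP[uB xB] := adj_verts eB.
(* Attaching along the path from [x], not from [u], makes [q] strictly shorter than the path from
   [u] to [v]. *)
have [w [q [wB wv wq qE le_q]]] := path_attachment bB xB xp.
rewrite -/v in wv qE.
have cut_block y z : y \in verts B -> z \in verts B -> y != z ->
    exists2 F : {set {set T}}, {in F &, injective f} & min_edge_cut G y z F.
  move=> yB zB yz; have [F injF minF] := cutB B bB y z yB zB yz.
  by exists F => //; apply: min_edge_cut_block bB _ _ minF.
have {le_q}le_q : size q < n by apply: leq_ltn_trans le_q le_n.
have [wE | vw] := eqVneq v w; first by rewrite wE in uv *; exact: cut_block.
(* If [u] is [w], then [q] already joins [u] to [v] and induction applies directly. *)
have [uE | uw] := eqVneq u w.
  by have := IH w q wq le_q; rewrite qE -uE; apply.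
have [F1 inj1 min1] := cut_block u w uB wB uw.
have [|F2 inj2] := IH w q wq le_q; first by rewrite qE eq_sym.
rewrite qE => min2.
have uw_sep F : connect (adj (del_edges G F)) u v -> connect (adj (del_edges G F)) u w.
  exact: connect_attachment bB uB wB wv.
have /orP[] : min_edge_cut G u v F1 || min_edge_cut G u v F2; last 2 first.
- by exists F1.
- by exists F2.
apply: min_edge_cut_separator min1 min2 => F /andP[FG nc]; rewrite /edge_cut FG /=.
  by apply: contra nc; apply: uw_sep.
apply: contra nc => cuv; apply: connect_trans (cuv).
by rewrite connect_adjC; exact: uw_sep.
Qed.

(** Each edge lies in exactly one block and takes its color from a fixed optimal coloring of that
    block. Blocks may share colors, since rainbow cuts are only required within each block. *)
Lemma srd_le_blocks G k : graph_connected G ->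
  (forall B, is_block G B -> srd B <= k) -> srd G <= k.
Proof.
move=> cG le_k.
(* The choice function must also be defined at non-edges, where [G] is a dummy value. *)
have /fin_all_exists[b bP] (e : {set T}) : exists B, e \in edges G -> is_block G B /\ e \in edges B.
  have [eG | _] := boolP (e \in edges G); last by exists G.
  by have [B bB eB] := block_of_edge eG; exists B.
(* One optimal coloring is fixed per code, so that all edges of a block consult the same one. *)
have /fin_all_exists[c cP] (VE : {set T} * {set {set T}}) : exists f : {set T} -> nat,
    {in edges (graph_of VE), forall e, f e < srd (graph_of VE)} /\
    rainbow_cuts (graph_of VE) f.
  by have /srd_colorableP[f] := srd_colorable_srd (graph_of VE); exists f.
pose code B := (verts B, edges B).
have bE B e : is_block G B -> e \in edges B -> b e = B.
  move=> bB eB; have [/andP[_ /subsetP BG] _ _] := bB.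
  by have [bbe ebe] := bP e (BG e eB); apply: block_unique bbe bB ebe eB.
apply/srd_min/srd_colorableP; exists (fun e => c (code (b e)) e).
  move=> e eG; have [bbe ebe] := bP e eG; apply: leq_trans (le_k _ bbe).
  by have [+ _] := cP (code (b e)); rewrite graph_ofK; apply.
apply: rainbow_cuts_blocks => // B bB u v uB vB uv.
have [_] := cP (code B); rewrite graph_ofK => /(_ u v uB vB uv)[F injF minF].
have /andP[/andP[/subsetP FB _] _] := minF.
exists F => // e e' eF e'F /=; rewrite !(bE B) ?FB //; exact: injF.
Qed.

End BlockColorings.

Theorem theorem2p12 (T : finType) (G B : graph T)
    (G_nontrivial : 1 < #|verts G|)
    (G_connected : graph_connected G)
    (B_block : is_block G B)
    (B_max : forall B' : graph T, is_block G B' -> srd B' <= srd B) :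
  srd G = srd B.
Proof. by apply/eqP; rewrite eqn_leq srd_le_blocks // srd_block_le. Qed.
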